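(* Let $G_1$ be a graph and let $G_2$ be a non-trivial bounded graph containing some odd cycle. Then the direct product $G_1\times G_2$ is hyperbolic if and only if $G_1$ is hyperbolic.
   Context: Conventions. A graph $G$ (such as $G_1,G_2$) is a nonempty, connected, simple (no loops, no multiple edges), possibly infinite graph; every edge has length $1$, and $G$ is regarded as a geodesic metric space by identifying each edge isometrically with $[0,1]$ and using the shortest-path distance $d_G$ (so points of $G$ are vertices and interior points of edges). A graph is trivial if it has exactly one vertex, and bounded if it has finite diameter. A cycle is a simple closed curve (a closed path with no repeated vertices except first = last); it is odd if its length is odd. Direct product: $G_1\times G_2$ has vertex set $V(G_1)\times V(G_2)$, and $(u_1,v_1)$, $(u_2,v_2)$ are adjacent iff $[u_1,u_2]\in E(G_1)$ and $[v_1,v_2]\in E(G_2)$. It may be disconnected. Hyperbolicity: in a geodesic metric space $X$, a geodesic triangle is the union of three geodesics $[x_1x_2],[x_2x_3],[x_3x_1]$; it is $\delta$-thin if each side is contained in the $\delta$-neighborhood of the union of the other two sides. $\delta(T)$ is the infimum of $\delta\ge 0$ such that $T$ is $\delta$-thin, $\delta(X):=\sup_T\delta(T)$ over all geodesic triangles $T$ in $X$, and $X$ is hyperbolic if $\delta(X)<\infty$. If $X$ has connected components $X_i$, then $\delta(X):=\sup_i\delta(X_i)$, and $X$ is hyperbolic if $\delta(X)<\infty$. *)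

(* Defs.v *)
From HB Require Import structures.
From mathcomp Require Import all_boot all_order all_algebra.
From mathcomp Require Import all_classical all_reals all_analysis.

Set Implicit Arguments.
Unset Strict Implicit.
Unset Printing Implicit Defensive.

Import Order.TTheory GRing.Theory Num.Theory.

Local Open Scope classical_set_scope.
Local Open Scope ring_scope.

(* Neither finiteness nor local finiteness nor connectedness is assumed here. *)
Record sgraph := SGraph {
  vertex :> choiceType;
  adj : rel vertex;
  adj_sym : symmetric adj;
  adj_irr : irreflexive adj
}.

Definition nonempty_graph (G : sgraph) : Prop := exists u : G, True.

Definition connected_graph (G : sgraph) : Prop :=
  forall u v : G, exists p : seq G, path (@adj G) u p /\ last u p = v.

Definition trivial_graph (G : sgraph) : Prop :=
  exists u : G, forall v : G, v = u.

Definition has_odd_cycle (G : sgraph) : Prop :=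
  exists c : seq G,
    [/\ cycle (@adj G) c, uniq c, (3 <= size c)%N & odd (size c)].

Section DirectProduct.
Variables G1 G2 : sgraph.

Definition dprod_adj : rel (G1 * G2) :=
  fun x y => adj x.1 y.1 && adj x.2 y.2.

Lemma dprod_adj_sym : symmetric dprod_adj.
Proof. by move=> x y; rewrite /dprod_adj adj_sym (adj_sym x.2). Qed.

Lemma dprod_adj_irr : irreflexive dprod_adj.
Proof. by move=> x; rewrite /dprod_adj adj_irr. Qed.

Definition direct_product : sgraph := SGraph dprod_adj_sym dprod_adj_irr.

End DirectProduct.

(* Geometric realization.  A point is given by its barycentric coordinates:
   [mix u v t] is the point of the edge [u, v] at distance t from u, and
   [mix u u t] is the vertex u.  Thus [mix u v t = mix v u (1 - t)], and
   [mix u v 0] does not depend on v. *)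
Section Realization.
Variables (R : realType) (G : sgraph).

Definition mix (u v : G) (t : R) : G -> R :=
  fun w => (1 - t) * (w == u)%:R + t * (w == v)%:R.

Definition is_point (x : G -> R) : Prop :=
  exists u v t, [/\ (u == v) || adj u v, 0 <= t <= 1 & x = mix u v t].

Record point := Point { coord :> G -> R; coordP : is_point coord }.

(* [edge_path x y l]: a concatenation of finitely many segments, each contained
   in an edge identified with [0, 1], goes from x to y and has total length l. *)
Inductive edge_path : (G -> R) -> (G -> R) -> R -> Prop :=
| edge_path_nil x : edge_path x x 0
| edge_path_cons u v s t y l :
    adj u v -> 0 <= s <= 1 -> 0 <= t <= 1 ->
    edge_path (mix u v t) y l -> edge_path (mix u v s) y (`|s - t| + l).

(* The value is +oo exactly when x and y lie in different components. *)
Definition gdist (x y : point) : \bar R :=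
  ereal_inf [set l%:E | l in [set l | edge_path x y l]].

End Realization.

(* The notions below are for a type X with an extended metric d, whose
   connected components are the classes of points at finite distance from each
   other (as is the case for the realization of a graph). *)
Section Hyperbolicity.
Variables (R : realType) (X : Type) (d : X -> X -> \bar R).

Definition diameter : \bar R := ereal_sup [set d p.1 p.2 | p in [set: X * X]].

Definition component (x : X) : set X := [set y | (d x y < +oo)%E].

(* A is (the image of) a geodesic from x to y. *)
Definition geodesic (x y : X) (A : set X) : Prop :=
  exists (L : R) (g : R -> X),
    [/\ 0 <= L, g 0 = x, g L = y,
        (forall s t, 0 <= s <= L -> 0 <= t <= L -> d (g s) (g t) = `|s - t|%:E)
      & A = g @` [set t | 0 <= t <= L]].

Record triangle := Triangle { side1 : set X; side2 : set X; side3 : set X }.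

Definition geodesic_triangle (T : triangle) : Prop :=
  exists x1 x2 x3 : X,
    [/\ geodesic x1 x2 (side1 T), geodesic x2 x3 (side2 T)
      & geodesic x3 x1 (side3 T)].

Definition neighborhood (e : R) (A : set X) : set X :=
  [set p | exists2 q, A q & (d p q <= e%:E)%E].

Definition thin (e : R) (T : triangle) : Prop :=
  [/\ side1 T `<=` neighborhood e (side2 T `|` side3 T),
      side2 T `<=` neighborhood e (side3 T `|` side1 T)
    & side3 T `<=` neighborhood e (side1 T `|` side2 T)].

Definition delta_triangle (T : triangle) : \bar R :=
  ereal_inf [set e%:E | e in [set e | 0 <= e /\ thin e T]].

Definition delta_on (C : set X) : \bar R :=
  ereal_sup [set delta_triangle T | T in
    [set T | geodesic_triangle T /\ side1 T `|` side2 T `|` side3 T `<=` C]].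

Definition delta : \bar R :=
  ereal_sup [set delta_on (component x) | x in [set: X]].

End Hyperbolicity.

Definition bounded_graph (R : realType) (G : sgraph) : Prop :=
  (diameter (@gdist R G) < +oo)%E.

Definition hyperbolic (R : realType) (G : sgraph) : Prop :=
  (delta (@gdist R G) < +oo)%E.

(* Main.v *)
(* A geodesic space has uniformly thin triangles if and only if it satisfies
   Gromov's four-point condition for some constant, and for a connected graph it
   suffices to test the latter on vertices.  If G2 is connected and bounded and
   has an odd cycle, there is N such that any two vertices of G2 are joined by
   walks of every length at least N.  Lifting to the product a shortest walk of
   G1, lengthened by 2N steps back and forth along an edge, shows that the
   projection to G1 preserves vertex distances up to the additive constant 2N, so
   the four-point condition passes in both directions.  If G1 is a single vertex,
   neither G1 nor the product has an edge. *)

Require Import Defs.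
From mathcomp Require Import all_boot all_order all_algebra.
From mathcomp Require Import all_classical all_reals all_analysis.
From mathcomp Require Import zify lra.

Set Implicit Arguments.
Unset Strict Implicit.
Unset Printing Implicit Defensive.

Import Order.TTheory GRing.Theory Num.Theory.

Local Open Scope classical_set_scope.
Local Open Scope ring_scope.

(** * The four-point condition, and finite delta as uniform thinness *)

Definition four_point (R : realType) (X : Type) (m : X -> X -> R) (C : R) :
  Prop :=
  forall x y z w : X,
    m x y + m z w <= m x z + m y w + C \/ m x y + m z w <= m x w + m y z + C.

Section Delta.
Variables (R : realType) (X : Type) (d : X -> X -> \bar R).

Lemma delta_finite_thin :
  (delta d < +oo)%E ->
  exists2 e : R, 0 <= e & forall T x, geodesic_triangle d T ->
    side1 T `|` side2 T `|` side3 T `<=` component d x -> thin d e T.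
Proof.
move=> dfin.
(* The bound is strict, so for each triangle the infimum of the thinness constants is below [e], and
   hence so is some actual constant [e']. *)
have [e e0 de] : exists2 e : R, 0 <= e & (delta d < e%:E)%E.
  case: (delta d) dfin => [r _| //|_]; last by exists 0 => //; rewrite ltNyr.
  exists (`|r| + 1); first by rewrite addr_ge0.
  by rewrite lte_fin; have := ler_norm r; lra.
exists e => // T x gT Tx.
have : (delta_triangle d T < e%:E)%E.
  apply: le_lt_trans de; apply: (@le_trans _ _ (delta_on d (component d x))).
    by apply: ereal_sup_ubound; exists T.
  by apply: ereal_sup_ubound; exists x.
move=> /ereal_inf_lt[_ [e' [e'0 [t1 t2 t3]] <-]]; rewrite lte_fin => e'e.
have sub A : neighborhood d e' A `<=` neighborhood d e A.
  by move=> p [q Aq pq]; exists q => //; apply: le_trans pq _; rewrite lee_fin ltW.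
by split=> p /[dup] sp; [move=> /t1|move=> /t2|move=> /t3]; apply: sub.
Qed.

Lemma thin_delta_finite (e : R) :
  0 <= e -> (forall T, geodesic_triangle d T -> thin d e T) -> (delta d < +oo)%E.
Proof.
move=> e0 H; apply: (@le_lt_trans _ _ e%:E); last exact: ltry.
apply: ub_ereal_sup => _ [x _ <-]; apply: ub_ereal_sup => _ [T [gT _] <-].
by apply: ereal_inf_lbound; exists e => //; split => //; apply: H.
Qed.

End Delta.

(** Replaces connectedness of the interval: moving from 0 in unit steps while [P] holds, one either
    meets [Q] at the next step or comes within 1 of [L]. *)
Lemma interval_crossing (R : realType) (P Q : R -> Prop) (L : R) :
  0 <= L -> P 0 -> Q L -> (forall t, 0 <= t <= L -> P t \/ Q t) ->
  exists s t, [/\ 0 <= s <= L, 0 <= t <= L, `|s - t| <= 1, P s & Q t].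
Proof.
move=> L0 P0 QL PQ.
suff H n a : 0 <= a <= L -> L - a <= n%:R -> P a ->
    exists s t, [/\ 0 <= s <= L, 0 <= t <= L, `|s - t| <= 1, P s & Q t].
  apply: (H (Num.bound L) 0) => //; first by rewrite lexx.
  by rewrite subr0 ltW// archi_boundP.
elim: n a => [|n IHn] a aL; rewrite -?natr1 => La Pa.
  exists a, L; split=> //; first lra.
  by rewrite ler_norml; lra.
have [L1|L1] := leP (L - a) 1.
  exists a, L; split=> //; first lra.
  by rewrite ler_norml; lra.
have a1L : 0 <= a + 1 <= L by lra.
have [P1|Q1] := PQ _ a1L; first by apply: (IHn (a + 1)) => //; lra.
by exists a, (a + 1); split=> //; rewrite ler_norml; lra.
Qed.

(** * Thin triangles versus the four-point condition, for a finite distance *)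

Section Gromov.
Variables (R : realType) (X : Type) (m : X -> X -> R).
Hypothesis m_refl : forall x, m x x = 0.
Hypothesis m_sym : forall x y, m x y = m y x.
Hypothesis m_triangle : forall x y z, m x z <= m x y + m y z.

Let d x y := (m x y)%:E.

Let m_ge0 x y : 0 <= m x y.
Proof. by have := m_triangle x y x; rewrite m_refl (m_sym y x); lra. Qed.

Lemma geodesicE x y A : geodesic d x y A ->
  exists g : R -> X, [/\ g 0 = x, g (m x y) = y,
    forall s t, 0 <= s <= m x y -> 0 <= t <= m x y -> m (g s) (g t) = `|s - t|
    & A = g @` [set t | 0 <= t <= m x y]].
Proof.
move=> [L [g [L0 g0 gL gi Ae]]].
have Lm : m x y = L.
  have [] : d (g 0) (g L) = `|0 - L|%:E by apply: gi; rewrite ?lexx L0.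
  by rewrite g0 gL sub0r normrN ger0_norm.
rewrite Lm; exists g; split => // s t hs ht.
by have [] := gi s t hs ht.
Qed.

Lemma geodesic_between x y A q : geodesic d x y A -> A q -> m x q + m q y = m x y.
Proof.
move=> /geodesicE[g [g0 gL gi ->]] [t /= ht <-].
have := m_ge0 x y => xy.
rewrite -[X in m X _ + _]g0 -[X in _ + m _ X = _]gL !gi ?lexx ?xy//.
by rewrite sub0r normrN ger0_norm ?ler0_norm; lra.
Qed.

(** Up to the error [4 * e + 2], the right-hand side is twice the Gromov product of [a] and [b] at
    [w]. Going along [A] from [a] to [b], one passes from points close to [D] to points close to
    [B], and a point at the transition is close to both. *)
Lemma geodesic_near_gromov_product (e : R) (a b w : X) (A B D : set X) :
  geodesic d a b A -> geodesic d b w B -> geodesic d w a D ->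
  A `<=` neighborhood d e (B `|` D) ->
  exists2 p, A p & 2 * m w p <= m w a + m w b - m a b + 4 * e + 2.
Proof.
move=> gA gB gD thinA.
have /geodesicE[g [g0 gL gi Ae]] := gA.
have mab := m_ge0 a b.
have mem x y E : geodesic d x y E -> E x /\ E y.
  move=> /geodesicE[h [h0 hL _ ->]]; have := m_ge0 x y => mxy.
  by split; [exists 0|exists (m x y)] => //=; rewrite lexx ?mxy.
have [AA AB] := mem _ _ _ gA.
have [BB BW] := mem _ _ _ gB.
have [DW DA] := mem _ _ _ gD.
have e0 : 0 <= e.
  by have [q _] := thinA _ AA; rewrite lee_fin; apply: le_trans.
have := @interval_crossing R (fun t => exists2 q, D q & m (g t) q <= e)
  (fun t => exists2 q, B q & m (g t) q <= e) (m a b) mab.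
case.
- by exists a => //; rewrite g0 m_refl.
- by exists b => //; rewrite gL m_refl.
- move=> t tL; have [|q [Bq|Dq] pq] := thinA (g t).
  + by rewrite Ae; exists t.
  + by right; exists q => //; rewrite -lee_fin.
  + by left; exists q => //; rewrite -lee_fin.
move=> s [t [sL tL st [q Dq pq] [r Br pr]]].
have As : A (g s) by rewrite Ae; exists s.
exists (g s) => //.
have E1 := geodesic_between gD Dq.
have E2 := geodesic_between gB Br.
have E3 := geodesic_between gA As.
have ts : m (g s) (g t) <= 1 by rewrite gi.
(* Through [q], [m w (g s)] is at most [m w a - m a (g s) + 2 * e]. Through [r], it is at most
   [m w b - m b (g s) + 2 * e + 2], the gap between [g s] and [g t] counting twice. The two bounds
   are added. *)
have := m_triangle w q (g s); have := m_triangle (g s) q a.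
have := m_triangle b r (g t); have := m_triangle w r (g t).
have := m_triangle w (g t) (g s); have := m_triangle b (g t) (g s).
rewrite (m_sym q (g s)) (m_sym r (g t)) (m_sym (g t) (g s)) (m_sym r w) in E2 *.
rewrite (m_sym (g s) a) (m_sym b w) (m_sym b (g s)) in E2 E3 *.
by move: E1 E2 E3 ts pq pr; lra.
Qed.

(** The map [p] is meant to be the inclusion of the vertices, so that geodesics have to be provided
    between vertices only. *)
Lemma thin_four_point (V : Type) (p : V -> X) :
  (forall u v, exists A, geodesic d (p u) (p v) A) -> (delta d < +oo)%E ->
  exists C, four_point (fun u v => m (p u) (p v)) C.
Proof.
move=> geo /delta_finite_thin[e e0 H].
have thinT A B D x y z : geodesic d x y A -> geodesic d y z B ->
    geodesic d z x D -> A `<=` neighborhood d e (B `|` D).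
  move=> gA gB gD; suff [] : thin d e (Triangle A B D) by [].
  apply: (H _ x); first by exists x, y, z.
  by move=> q _; rewrite /component /= /d ltry.
(* [4 * e + 2] comes from the point [a] of the side from [x] to [z], and [2 * e] from counting twice
   the step from [a] to a point [q] of another side. Since [q] lies on that side, the distances from
   [w] to its two ends add up to at most its length plus twice the distance from [w] to [q]. *)
exists (6 * e + 2) => x z y w.
have [A gA] := geo x z; have [B gB] := geo z w; have [D gD] := geo w x.
have [B' gB'] := geo z y; have [D' gD'] := geo y x.
have [a Aa ha] := geodesic_near_gromov_product gA gB gD (thinT _ _ _ _ _ _ gA gB gD).
have [q + aq] := thinT _ _ _ _ _ _ gA gB' gD' a Aa.
rewrite lee_fin in aq.
have waq := m_triangle (p w) a q.
case=> [Bq|Dq].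
  right; have E := geodesic_between gB' Bq.
  have := m_triangle (p z) q (p w); have := m_triangle (p w) q (p y).
  rewrite (m_sym q (p w)) (m_sym (p y) (p w)) (m_sym (p x) (p w)).
  by rewrite (m_sym (p z) (p w)) in ha E *; lra.
left; have E := geodesic_between gD' Dq.
have := m_triangle (p x) q (p w); have := m_triangle (p w) q (p y).
rewrite (m_sym q (p w)) (m_sym (p x) (p y)) (m_sym (p z) (p w)).
rewrite (m_sym q (p y)) (m_sym (p x) q) (m_sym (p x) (p w)) (m_sym (p y) (p w)).
by lra.
Qed.

(** The four-point condition is applied to [p], [a], [b] and the point of the geodesic as far from
    [a] as [p] is. *)
Lemma almost_between_near_geodesic (C : R) (a b p : X) (B : set X) :
  four_point m C -> geodesic d a b B -> m p a + m p b <= m a b + C ->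
  exists2 q, B q & m p q <= 2 * C.
Proof.
move=> m4 /geodesicE[g [g0 gL gi ->]] pab.
have C0 : 0 <= C by have := m4 a a a a; rewrite m_refl; case; lra.
have := m_ge0 a b; have := m_ge0 p a; have := m_ge0 p b => pb pa ab.
(* The minimum keeps [t] in the domain of [g]: [m p a] may exceed [m a b], but by at most [C]. *)
pose t := Num.min (m p a) (m a b).
have tL : 0 <= t <= m a b by rewrite le_min pa ab ge_min lexx orbT.
have E1 : m (g t) a = t.
  by rewrite -[X in m _ X]g0 gi ?lexx ?ab// subr0 ger0_norm//; case/andP: tL.
have E2 : m (g t) b = m a b - t.
  by rewrite -[X in m _ X]gL gi ?lexx ?ab// ler0_norm; lra.
exists (g t); first by exists t.
have := m4 p (g t) a b; rewrite E1 E2 /t.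
by case: (leP (m p a) (m a b)); case; lra.
Qed.

Lemma four_point_thin (C : R) : four_point m C -> (delta d < +oo)%E.
Proof.
move=> m4.
have side x y z A B D : geodesic d x y A -> geodesic d y z B ->
    geodesic d z x D -> A `<=` neighborhood d (2 * C) (B `|` D).
  move=> gA gB gD p Ap; have E := geodesic_between gA Ap.
  rewrite (m_sym x p) in E.
  (* Since [p] splits [m x y], each alternative says that [p] is almost between [z] and one of [y],
     [x]. *)
  have [H|H] := m4 p z x y.
    have [|q Bq pq] := almost_between_near_geodesic (p := p) m4 gB.
      by rewrite (m_sym y z); lra.
    by exists q; [left|rewrite lee_fin].
  have [|q Dq pq] := almost_between_near_geodesic (p := p) m4 gD; first lra.
  by exists q; [right|rewrite lee_fin].
(* The sign of [C] is read off at a point, so an empty space is treated apart. *)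
have [[x _]|X0] := pselect (exists x : X, True); last first.
  by apply: (@thin_delta_finite _ _ _ 0) => // T [x]; case: X0; exists x.
have C0 : 0 <= C by have := m4 x x x x; rewrite m_refl; case; lra.
apply: (@thin_delta_finite _ _ _ (2 * C)); first lra.
by move=> T [x1 [x2 [x3 [g1 g2 g3]]]]; split; apply: side; eassumption.
Qed.

End Gromov.

(** * Walks and the combinatorial distance *)

Fixpoint walk (G : sgraph) (n : nat) (u v : G) : Prop :=
  if n is k.+1 then exists2 w, adj u w & walk k w v else u = v.

Lemma walk_cat (G : sgraph) (n k : nat) (u v w : G) :
  walk n u v -> walk k v w -> walk (n + k) u w.
Proof.
by elim: n u => [|n IHn] u /= => [-> //|[x ux xv] vw]; exists x => //; apply: IHn.
Qed.

Lemma walk1 (G : sgraph) (u v : G) : adj u v -> walk 1 u v.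
Proof. by exists v. Qed.

Lemma walk_sym (G : sgraph) (n : nat) (u v : G) : walk n u v -> walk n v u.
Proof.
elim: n u v => [//|n IHn] u v [w uw /IHn wv].
by rewrite -addn1; apply: walk_cat wv _; apply: walk1; rewrite adj_sym.
Qed.

Lemma walk_path (G : sgraph) (u : G) (p : seq G) :
  path (@adj G) u p -> walk (size p) u (last u p).
Proof.
by elim: p u => [//|v p IHp] u /= /andP[uv /IHp]; exists v.
Qed.

Lemma path_walk (G : sgraph) (n : nat) (u v : G) : walk n u v ->
  exists p : seq G, path (@adj G) u p /\ last u p = v.
Proof.
elim: n u => [|n IHn] u /=; first by exists [::].
by move=> [w uw /IHn[p [up lp]]]; exists (w :: p); rewrite /= uw.
Qed.

Lemma walk_double (G : sgraph) (k : nat) (u w : G) : adj u w -> walk k.*2 u u.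
Proof.
move=> uw; elim: k => [//|k IHk]; rewrite doubleS.
by exists w => //; exists u; rewrite // adj_sym.
Qed.

Lemma walk_pad (G : sgraph) (n k : nat) (u v w : G) :
  adj u w -> walk n u v -> walk (k.*2 + n) u v.
Proof. by move=> uw; apply: walk_cat; apply: walk_double uw. Qed.

(* [dist u v] is [0] when no walk joins [u] to [v]. *)
Definition dist (G : sgraph) (u v : G) : nat :=
  if pselect (exists n, `[< walk n u v >]) is left H then ex_minn H else 0%N.

Lemma dist_le (G : sgraph) (n : nat) (u v : G) : walk n u v -> (dist u v <= n)%N.
Proof.
move=> /asboolP uv; rewrite /dist; case: pselect => // H.
by case: ex_minnP => k _; apply.
Qed.

Lemma dist_walk (G : sgraph) (u v : G) :
  connected_graph G -> walk (dist u v) u v.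
Proof.
move=> /(_ u v)[p [/walk_path up lp]]; rewrite lp in up.
rewrite /dist; case: pselect => [H|[]]; last by exists (size p); apply/asboolP.
by case: ex_minnP => k /asboolP.
Qed.

Lemma dist_adj (G : sgraph) (u v w : G) :
  connected_graph G -> adj v w -> (dist u w <= (dist u v).+1)%N.
Proof.
move=> Gc vw; rewrite -addn1; apply: dist_le.
by apply: walk_cat (walk1 vw); apply: dist_walk.
Qed.

(** * The path metric of the realization *)

Section Realization.
Variables (R : realType) (G : sgraph).
Implicit Types (u v w : G) (x y z : G -> R) (s t l : R).

Lemma mixC u v t : mix u v t = mix v u (1 - t).
Proof. by apply/funext => w; rewrite /mix addrC opprB addrCA subrr addr0. Qed.

Lemma mix0 u v : mix u v 0 = mix u u 0 :> (G -> R).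
Proof. by apply/funext => w; rewrite /mix !mul0r. Qed.

Lemma mix1 u v : mix u v 1 = mix v v 0 :> (G -> R).
Proof. by rewrite mixC subrr mix0. Qed.

Lemma mixx u t : mix u u t = mix u u 0.
Proof. by apply/funext => w; rewrite /mix; lra. Qed.

Lemma edge_path_ge0 x y l : edge_path x y l -> 0 <= l.
Proof. by elim=> // *; rewrite addr_ge0. Qed.

Lemma edge_path_cat x y z l l' :
  edge_path x y l -> edge_path y z l' -> edge_path x z (l + l').
Proof.
move=> xy; elim: xy z l' => [y0|u v s t y0 l0 uv hs ht _ IH] z l' yz.
  by rewrite add0r.
by rewrite -addrA; apply: edge_path_cons => //; apply: IH.
Qed.

Lemma edge_path_edge u v s t : adj u v -> 0 <= s <= 1 -> 0 <= t <= 1 ->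
  edge_path (mix u v s) (mix u v t) `|s - t|.
Proof.
move=> uv hs ht; rewrite -[`|_|]addr0.
by apply: edge_path_cons => //; apply: edge_path_nil.
Qed.

Lemma edge_path_sym x y l : edge_path x y l -> edge_path y x l.
Proof.
elim=> [z|u v s t z l' uv hs ht _ IH]; first exact: edge_path_nil.
by rewrite addrC distrC; apply: edge_path_cat IH _; apply: edge_path_edge.
Qed.

Lemma edge_path_walk (n : nat) u v :
  walk n u v -> edge_path (mix u u 0) (mix v v 0) (n%:R : R).
Proof.
elim: n u => [|n IHn] u /=; first by move=> ->; apply: edge_path_nil.
move=> [w uw /IHn wv]; rewrite -natr1 addrC.
have -> : 1 + n%:R = `|0 - 1| + n%:R :> R by rewrite sub0r normrN normr1.
rewrite -(mix0 u w); apply: edge_path_cons => //; rewrite ?lexx ?ler01//.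
by rewrite mix1.
Qed.

Lemma point_eq (p q : Defs.point R G) : Defs.coord p = Defs.coord q -> p = q.
Proof.
case: p q => [x xP] [y yP] /= xy; subst y; congr Point.
exact: Prop_irrelevance.
Qed.

Lemma is_point_vertex u : is_point (mix u u (0 : R)).
Proof. by exists u, u, 0; rewrite eqxx lexx ler01. Qed.

Definition vertex_point u : Defs.point R G := Point (is_point_vertex u).

Lemma near_vertex (p : Defs.point R G) :
  exists u l, l <= 1 /\ edge_path p (vertex_point u) l.
Proof.
have [u [v [t [uv ht ->]]]] := coordP p; exists u => /=.
case/orP: uv => [/eqP<-|uv].
  exists 0; rewrite ler01 mixx; split=> //; exact: edge_path_nil.
exists t; split; first by case/andP: ht.
rewrite -(mix0 u v); case/andP: (ht) => t0 _.
rewrite -{2}(ger0_norm t0) -{2}(subr0 t).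
by apply: edge_path_edge; rewrite ?lexx ?ler01.
Qed.

(* The affine extension of a function on vertices to points; the sum over all
   vertices has at most two nonzero terms. *)
Definition affine_ext (f : G -> R) x : R := \sum_(w \in [set: G]) x w * f w.

Lemma affine_ext_mix (f : G -> R) u v t : (u == v) || adj u v ->
  affine_ext f (mix u v t) = (1 - t) * f u + t * f v.
Proof.
move=> uv; rewrite /affine_ext.
(* The list supporting the sum must be duplicate-free, hence the separate degenerate case. *)
have [<-|neq] := eqVneq u v.
  rewrite (@fsbigE _ _ _ _ _ [:: u])//; last first.
    by move=> w _; rewrite inE mixx /mix => /negbTE->; rewrite !mulr0 addr0 mul0r.
  by rewrite big_mkcond big_seq1 in_setT mixx /mix eqxx /=; lra.
rewrite (@fsbigE _ _ _ _ _ [:: u; v])//.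
- rewrite big_mkcond !big_cons big_nil !in_setT /mix !eqxx [v == u]eq_sym (negbTE neq) /=.
  by lra.
- by rewrite /= inE neq.
- move=> w _; rewrite !inE negb_or /mix => /andP[/negbTE-> /negbTE->].
  by rewrite !mulr0 addr0 mul0r.
Qed.

(** This bounds lengths of edge paths from below: on each edge the extension is affine with slope at
    most 1 in absolute value. *)
Lemma affine_ext_lipschitz (f : G -> R) x y l :
  (forall u v, adj u v -> `|f u - f v| <= 1) ->
  edge_path x y l -> `|affine_ext f x - affine_ext f y| <= l.
Proof.
move=> flip; elim=> [z|u v s t z l' uv hs ht _ IH]; first by rewrite subrr normr0.
rewrite -(subrKA (affine_ext f (mix u v t))); apply: le_trans (ler_normD _ _) _.
apply: lerD IH; rewrite !affine_ext_mix ?uv ?orbT//.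
have -> : (1 - s) * f u + s * f v - ((1 - t) * f u + t * f v)
  = (s - t) * (f v - f u) by lra.
by rewrite normrM ler_piMr// distrC flip.
Qed.

(** The real-valued form of [gdist]. Its default value 0, for points that no edge path joins, does
    not occur once the graph is connected. *)
Definition rdist (p q : Defs.point R G) : R := inf [set l | edge_path p q l].

Lemma rdist_le (p q : Defs.point R G) l : edge_path p q l -> rdist p q <= l.
Proof. by move=> pq; apply: ge_inf => //; exists 0 => k /edge_path_ge0. Qed.

Lemma rdist_refl (p : Defs.point R G) : rdist p p = 0.
Proof.
have pp := edge_path_nil (Defs.coord p).
apply/eqP; rewrite eq_le rdist_le//=.
by apply: lb_le_inf; [exists 0|move=> l /edge_path_ge0].
Qed.

Lemma rdist_sym (p q : Defs.point R G) : rdist p q = rdist q p.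
Proof. by congr inf; apply/seteqP; split=> l /edge_path_sym. Qed.

Hypothesis Gc : connected_graph G.

Lemma edge_path_exists (p q : Defs.point R G) : exists l, edge_path p q l.
Proof.
have [u [l [_ pu]]] := near_vertex p; have [v [k [_ qv]]] := near_vertex q.
exists (l + ((dist u v)%:R + k)).
apply: edge_path_cat pu _; apply: edge_path_cat (edge_path_sym qv).
by apply: edge_path_walk; apply: dist_walk.
Qed.

Lemma le_rdist (p q : Defs.point R G) (r : R) :
  (forall l, edge_path p q l -> r <= l) -> r <= rdist p q.
Proof. by move=> H; apply: lb_le_inf => //; apply: edge_path_exists. Qed.

Lemma gdistE : @gdist R G = fun p q => (rdist p q)%:E.
Proof.
apply/funext => p; apply/funext => q; rewrite /gdist ereal_inf_EFin//.
  by exists 0 => l /edge_path_ge0.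
exact: edge_path_exists.
Qed.

Lemma rdist_triangle (p q r : Defs.point R G) : rdist p r <= rdist p q + rdist q r.
Proof.
rewrite -lerBlDr; apply: le_rdist => l pq; rewrite lerBlDr addrC -lerBlDr.
apply: le_rdist => k qr; rewrite lerBlDr addrC; apply: rdist_le.
exact: edge_path_cat pq qr.
Qed.

Lemma rdist_vertex u v : rdist (vertex_point u) (vertex_point v) = (dist u v)%:R.
Proof.
apply/eqP; rewrite eq_le; apply/andP; split.
  by apply: rdist_le; apply: edge_path_walk; apply: dist_walk.
(* The distance from [u] changes by at most 1 along an edge, and its affine extension goes from 0 to
   [dist u v]. *)
apply: le_rdist => l /(@affine_ext_lipschitz (fun w => (dist u w)%:R)).
rewrite !affine_ext_mix ?eqxx// !subr0 !mul1r !mul0r !addr0.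
have -> : dist u u = 0%N by apply/eqP; rewrite -leqn0; apply: dist_le.
rewrite sub0r normrN ger0_norm//; apply => a b ab.
have := dist_adj u Gc ab; have := dist_adj u Gc (etrans (adj_sym b a) ab).
rewrite -!(ler_nat R) -!natr1 => H1 H2.
by rewrite ler_norml; lra.
Qed.

Lemma edge_param u v : adj u v ->
  exists g : R -> Defs.point R G, [/\ g 0 = vertex_point u, g 1 = vertex_point v &
    forall s t, 0 <= s -> s <= t -> t <= 1 -> rdist (g s) (g t) <= t - s].
Proof.
(* Clamping to [0, 1] yields a point of the edge for every real [t]. *)
move=> uv; pose c t : R := Num.max 0 (Num.min t 1).
have c01 t : 0 <= c t <= 1.
  by rewrite /c le_max lexx ge_max ler01 ge_min lexx orbT.
have cE t : 0 <= t -> t <= 1 -> c t = t.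
  by move=> t0 t1; rewrite /c (min_idPl t1) (max_idPr t0).
have cp t : is_point (mix u v (c t)) by exists u, v, (c t); rewrite uv orbT.
exists (fun t => Point (cp t)); split.
- by apply: point_eq; rewrite /= cE ?lexx ?ler01// mix0.
- by apply: point_eq; rewrite /= cE ?lexx ?ler01// mix1.
move=> s t s0 st t1; apply: rdist_le => /=.
rewrite !cE ?(le_trans s0 st) ?(le_trans st t1)//.
rewrite -[t - s]opprB -ler0_norm ?subr_le0//; apply: edge_path_edge => //.
- by rewrite s0 (le_trans st t1).
- by rewrite (le_trans s0 st) t1.
Qed.

Lemma walk_param (n : nat) u v : walk n u v ->
  exists g : R -> Defs.point R G, [/\ g 0 = vertex_point u, g n%:R = vertex_point v &
    forall s t, 0 <= s -> s <= t -> t <= n%:R -> rdist (g s) (g t) <= t - s].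
Proof.
elim: n u => [|n IHn] u /=.
  move=> ->; exists (fun=> vertex_point v); split=> // s t s0 st tn.
  by rewrite rdist_refl subr_ge0.
move=> [w uw /IHn[h [h0 hn hlip]]].
have [e [e0 e1 elip]] := edge_param uw; rewrite -h0 in e1.
exists (fun t => if t <= 1 then e t else h (t - 1)); split.
- by rewrite ler01.
(* For [n = 0] the final parameter is 1, which falls in the branch of [e]. *)
- rewrite -natr1; case: n hn {IHn hlip} => [|n] hn.
    by rewrite add0r lexx e1 -hn.
  by rewrite leNgt ltrDr ltr0n /= addrK.
rewrite -natr1 => s t s0 st tn; case: (leP s 1) => s1; case: (leP t 1) => t1.
- exact: elip.
- apply: le_trans (rdist_triangle _ (e 1) _) _; rewrite [X in _ + rdist X _]e1.
  have := elip s 1 s0 s1 (lexx _); have := hlip 0 (t - 1) (lexx _); lra.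
- lra.
- by have := hlip (s - 1) (t - 1); lra.
Qed.

(** A 1-Lipschitz path whose parameter length equals the distance of its ends is a geodesic, as a
    shortcut between two of its points would shorten the whole. *)
Lemma vertex_geodesic u v :
  exists A, geodesic (@gdist R G) (vertex_point u) (vertex_point v) A.
Proof.
have [g [g0 gn glip]] := walk_param (dist_walk u v Gc).
exists (g @` [set t | 0 <= t <= (dist u v)%:R]); exists (dist u v)%:R, g.
split=> // s t; rewrite gdistE.
wlog st : s t / s <= t.
  move=> H hs ht; have [st|/ltW ts] := leP s t; first exact: H.
  by rewrite rdist_sym distrC; apply: H.
move=> /andP[s0 sn] /andP[t0 tn]; congr EFin; apply/eqP.
rewrite ler0_norm ?opprB ?subr_le0// eq_le glip//=.
have := rdist_triangle (g 0) (g s) (g (dist u v)%:R).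
have := rdist_triangle (g s) (g t) (g (dist u v)%:R).
rewrite g0 gn rdist_vertex.
have := glip 0 s; have := glip t (dist u v)%:R; rewrite g0 gn; lra.
Qed.

Lemma hyperbolic_four_point :
  hyperbolic R G <-> exists C : R, four_point (fun u v => (dist u v)%:R) C.
Proof.
rewrite /hyperbolic; have geo := vertex_geodesic; rewrite gdistE in geo *.
split=> [/(thin_four_point rdist_refl rdist_sym rdist_triangle geo)[C m4]|[C m4]].
  by exists C => u v w a; have := m4 u v w a; rewrite !rdist_vertex.
(* Moving both points to vertices within distance 1 changes a distance by at most 2, and the
   inequality involves four distances. *)
apply: (four_point_thin rdist_refl rdist_sym rdist_triangle (C := C + 8)).
have near p : exists u, rdist p (vertex_point u) <= 1.
  have [u [l [l1 pu]]] := near_vertex p; exists u.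
  by apply: le_trans (rdist_le pu) l1.
have approx p q u v : rdist p (vertex_point u) <= 1 ->
    rdist q (vertex_point v) <= 1 -> `|rdist p q - (dist u v)%:R| <= 2.
  move=> pu qv; rewrite -rdist_vertex ler_norml.
  have := rdist_triangle p (vertex_point u) q.
  have := rdist_triangle (vertex_point u) (vertex_point v) q.
  have := rdist_triangle (vertex_point u) p (vertex_point v).
  have := rdist_triangle p q (vertex_point v).
  rewrite (rdist_sym (vertex_point v)) (rdist_sym (vertex_point u) p); lra.
move=> x y z w.
have [[a xa] [b yb]] := (near x, near y).
have [[c zc] [e we]] := (near z, near w).
have := approx _ _ _ _ xa yb; have := approx _ _ _ _ zc we.
have := approx _ _ _ _ xa zc; have := approx _ _ _ _ yb we.
have := approx _ _ _ _ xa we; have := approx _ _ _ _ yb zc.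
rewrite !ler_norml => h1 h2 h3 h4 h5 h6.
by case: (m4 a b c e) => H; [left|right]; lra.
Qed.

End Realization.

(** Every edge path is constant, so distinct points are at infinite distance and geodesics are
    single points. This covers disconnected graphs, which the criterion on vertices does not. *)
Lemma edgeless_hyperbolic (R : realType) (G : sgraph) :
  (forall u v : G, ~~ adj u v) -> hyperbolic R G.
Proof.
move=> noadj.
have epE x y l : @edge_path R G x y l -> x = y /\ l = 0.
  by case=> [//|u v s t z k]; rewrite (negbTE (noadj u v)).
have dE (p q : Defs.point R G) (r : R) : gdist p q = r%:E -> p = q.
  move=> pq; have : (gdist p q < (r + 1)%:E)%E by rewrite pq lte_fin ltrDl.
  by move=> /ereal_inf_lt[_ [l pq' _] _]; have [/point_eq] := epE _ _ _ pq'.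
have gdistxx (p : Defs.point R G) : (gdist p p <= 0%:E)%E.
  by apply: ereal_inf_lbound; exists 0 => //; apply: edge_path_nil.
have gE x y A : geodesic (@gdist R G) x y A -> A = [set x] /\ y = x.
  move=> [L [g [L0 g0 gL gi ->]]].
  have gx t : 0 <= t <= L -> g t = x.
    move=> ht; rewrite -g0; symmetry; apply: (dE _ _ `|0 - t|).
    by apply: gi; rewrite ?lexx.
  split; last by rewrite -gL gx// lexx L0.
  apply/seteqP; split=> [_ [t ht <-]|_ ->]; first exact: gx.
  by exists 0 => //=; rewrite lexx.
apply: (@thin_delta_finite _ _ _ 0) => // -[A1 A2 A3].
move=> [x [y [z []]]] /= /gE[-> ->] /gE[-> ->] /gE[-> _].
by split=> p -> /=; exists x => //; left.
Qed.

(** * Walks of prescribed length, and distances in the product *)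

Lemma adj_neighbor (G : sgraph) (u : G) :
  connected_graph G -> ~ trivial_graph G -> exists v, adj u v.
Proof.
move=> Gc Gn; have [//|no] := pselect (exists v, adj u v).
case: Gn; exists u => v; have /path_walk := dist_walk u v Gc.
by case: (Gc u v) => -[|w p] [/= uw <- //]; case: no; exists w; case/andP: uw.
Qed.

Lemma bounded_dist (R : realType) (G : sgraph) :
  connected_graph G -> bounded_graph R G ->
  exists K : nat, forall u v : G, (dist u v <= K)%N.
Proof.
move=> Gc; rewrite /bounded_graph (gdistE R Gc) => bG.
have [r dr] : exists r : R, (diameter (fun p q => (@rdist R G p q)%:E) < r%:E)%E.
  case: (diameter _) bG => [r _| //|_]; last by exists 0; rewrite ltNyr.
  by exists (r + 1); rewrite lte_fin ltrDl.
exists (Num.bound `|r|) => u v; rewrite -(ler_nat R) -rdist_vertex//.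
have : ((rdist (vertex_point R u) (vertex_point R v))%:E < r%:E)%E.
  apply: le_lt_trans dr; apply: ereal_sup_ubound.
  by exists (vertex_point R u, vertex_point R v).
rewrite lte_fin => /ltW /le_trans; apply; apply: le_trans (ler_norm r) _.
by apply: ltW; apply: archi_boundP.
Qed.

(* Going through the odd cycle or not adjusts the parity of a walk, and going
   back and forth along an edge then adjusts its length. *)
Lemma long_walks (G : sgraph) (K : nat) :
  connected_graph G -> has_odd_cycle G -> (forall u v : G, (dist u v <= K)%N) ->
  exists N, forall n (u v : G), (N <= n)%N -> walk n u v.
Proof.
move=> Gc [c [cyc _ _ oddc]] bK.
case: c cyc oddc => [//|a p]; rewrite /cycle => ap.
rewrite -[size (a :: p)](size_rcons p a) => oddp.
have := walk_path ap; rewrite last_rcons => aa.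
have [b ab] : exists b, adj a b.
  by case: (p) ap => [|b q] /= /andP[ab _]; [exists a|exists b].
move: (size _) oddp aa => k oddk aa.
(* [K + K] allows for going from [u] to [a] and from [a] to [v], and [k] for the odd closed walk at
   [a]; the remaining length is even. *)
exists (K + K + k)%N => n u v nK.
have ua := dist_walk u a Gc; have av := dist_walk a v Gc.
have := bK u a; have := bK a v.
move: (dist u a) (dist a v) ua av => i j ua av jK iK.
have pad m : walk m a a -> (m <= k)%N -> odd m = odd (n - (i + j)) -> walk n u v.
  move=> am mk om.
  have -> : n = (i + (((n - (i + j) - m)./2).*2 + m + j))%N by lia.
  by apply: walk_cat ua _; apply: walk_cat av; apply: walk_pad ab am.
have [odd1|even1] := boolP (odd (n - (i + j))).
  by apply: (pad k) => //; rewrite oddk odd1.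
by apply: (pad 0%N) => //; rewrite (negbTE even1).
Qed.

(** Both coordinates move at every step, so their walks have a common length; this is the source of
    the parity constraint that the odd cycle lifts. *)
Lemma walk_product (G1 G2 : sgraph) (n : nat) (x y : direct_product G1 G2) :
  walk n x y <-> walk n x.1 y.1 /\ walk n x.2 y.2.
Proof.
elim: n x => [|n IHn] [u v] /=; first by case: y => u' v'; split=> [[-> ->]|[-> ->]].
split=> [[[a b] /andP[/= ua vb] /IHn[/= ay byy]]|].
  by split; [exists a|exists b].
move=> [[a ua ay] [b vb byy]].
by exists (a, b); [rewrite /= /dprod_adj /= ua vb|apply/IHn].
Qed.

Lemma dist_product (G1 G2 : sgraph) (N : nat) :
  connected_graph G1 -> ~ trivial_graph G1 ->
  (forall n (u v : G2), (N <= n)%N -> walk n u v) ->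
  connected_graph (direct_product G1 G2) /\
  forall x y : direct_product G1 G2,
    (dist x.1 y.1 <= dist x y <= dist x.1 y.1 + N.*2)%N.
Proof.
move=> Gc Gn G2w.
(* [N.*2] is even, so the walk in [G1] can be padded along an edge, and at least [N], so [G2] has a
   walk of the same length. *)
have w x y : walk (N.*2 + dist x.1 y.1) (x : direct_product G1 G2) y.
  apply/walk_product; have [b ab] := adj_neighbor x.1 Gc Gn; split.
    by apply: walk_pad ab _; apply: dist_walk.
  by apply: G2w; rewrite -addnn -addnA leq_addr.
have Pc : connected_graph (direct_product G1 G2).
  by move=> x y; apply: path_walk (w x y).
split=> // x y; apply/andP; split; last by rewrite addnC dist_le.
by apply: dist_le; have /walk_product[] := dist_walk x y Pc.
Qed.

Theorem theorem2p11 (R : realType) (G1 G2 : sgraph)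
    (G1_nonempty : nonempty_graph G1) (G1_connected : connected_graph G1)
    (G2_nonempty : nonempty_graph G2) (G2_connected : connected_graph G2)
    (G2_nontrivial : ~ trivial_graph G2)
    (G2_bounded : bounded_graph R G2)
    (G2_odd_cycle : has_odd_cycle G2) :
  hyperbolic R (direct_product G1 G2) <-> hyperbolic R G1.
Proof.
have [[u uP]|G1_nontrivial] := pselect (trivial_graph G1).
  have noadj (a b : G1) : ~~ adj a b by rewrite (uP a) (uP b) adj_irr.
  split=> _; apply: edgeless_hyperbolic => // x y.
  by rewrite /= /dprod_adj (negbTE (noadj _ _)).
have [K bK] := bounded_dist G2_connected G2_bounded.
have [N wN] := long_walks G2_connected G2_odd_cycle bK.
have [Pc dP] := dist_product G1_connected G1_nontrivial wN.
have {}dP (x y : direct_product G1 G2) :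
    (dist x.1 y.1)%:R <= (dist x y)%:R :> R /\
    (dist x y)%:R <= (dist x.1 y.1)%:R + (N.*2)%:R :> R.
  by have /andP[? ?] := dP x y; rewrite -natrD !ler_nat.
(* The comparison [dP] is one-sided, so only two of the four distances, those on one side of the
   inequality, cost [N.*2] each. *)
rewrite !hyperbolic_four_point//; split=> -[C m4]; exists (C + 2 * (N.*2)%:R).
  (* Vertices of [G1] are lifted to the layer over a fixed [v0]. *)
  case: G2_nonempty => v0 _ x y z w.
  have := dP (x, v0) (y, v0); have := dP (z, v0) (w, v0).
  have := dP (x, v0) (z, v0); have := dP (y, v0) (w, v0).
  have := dP (x, v0) (w, v0); have := dP (y, v0) (z, v0).
  move=> /= [? ?] [? ?] [? ?] [? ?] [? ?] [? ?].
  by case: (m4 (x, v0) (y, v0) (z, v0) (w, v0)); [left|right]; lra.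
move=> x y z w.
have := dP x y; have := dP z w; have := dP x z; have := dP y w.
have := dP x w; have := dP y z.
move=> [? ?] [? ?] [? ?] [? ?] [? ?] [? ?].
by case: (m4 x.1 y.1 z.1 w.1); [left|right]; lra.
Qed.
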